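(* Let $R$ be a commutative Noetherian local ring and let $I$ be a (proper) ideal of $R$. Then $D(D(I))=D(I)$.
   Context: For a proper ideal $I$ of grade $g$, $D(I):=\mathrm{Ann}_R(\mathrm{Ext}^g_R(R/I,R))$. *)

(* Defs.v *)
From HB Require Import structures.
From mathcomp Require Import all_boot all_algebra.
From mathcomp Require Import ring_quotient.
From mathcomp Require Import boolp classical_sets functions.
From mathcomp Require Import freeg.

Set Implicit Arguments.
Unset Strict Implicit.
Unset Printing Implicit Defensive.
Import GRing.Theory.
Local Open Scope ring_scope.
Local Open Scope quotient_scope.

(* Ideals of R are the submodules of the regular module, [submodClosed R^o];
   they may be improper.  (The library's [idealr] only has proper ideals.) *)

Section SubmoduleType.
Variables (R : nzRingType) (V : lmodType R) (W : submodClosed V).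

Record submod : Type := Submod { submod_val : V; _ : submod_val \in W }.

HB.instance Definition _ := [isSub for submod_val].
HB.instance Definition _ := [Choice of submod by <:].
HB.instance Definition _ := [SubChoice_isSubLmodule of submod by <:].

End SubmoduleType.

Section QuotientModule.
Variables (R : nzRingType) (V : lmodType R) (W : submodClosed V).

(* W again, registered as closed under opposite, as [Quotient.quot] requires. *)
Definition submod_zmod : {pred V} := W.

Fact submod_zmodP : zmod_closed submod_zmod.
Proof. exact: (GRing.submodClosedP W). Qed.

HB.instance Definition _ := GRing.isZmodClosed.Build V submod_zmod submod_zmodP.

Definition quotmod : Type := Quotient.quot submod_zmod.
HB.instance Definition _ := GRing.Zmodule.on quotmod.
HB.instance Definition _ : EqQuotient V (Quotient.equiv submod_zmod) quotmod :=
  EqQuotient.on quotmod.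
HB.instance Definition _ := @isZmodQuotient.Build V
  (Quotient.equiv submod_zmod) 0 -%R +%R quotmod
  (@pi_zeror _ _ _ _ _ (Quotient.quot submod_zmod))
  (@pi_oppr _ _ _ _ _ (Quotient.quot submod_zmod))
  (@pi_addr _ _ _ _ _ (Quotient.quot submod_zmod)).

Definition quotmod_scale (a : R) (x : quotmod) : quotmod :=
  \pi_quotmod (a *: repr x).

Fact quotmod_scale_pi a (v : V) :
  quotmod_scale a (\pi_quotmod v) = \pi_quotmod (a *: v).
Proof.
have /= Weq (x y : V) : (x - y \in W) = (\pi_quotmod x == \pi_quotmod y).
  exact: (Quotient.idealrBE submod_zmod).
apply/eqP; rewrite -Weq -scalerBr; apply: rpredZ; rewrite Weq.
by rewrite reprK.
Qed.

Fact quotmod_scaleA a b x :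
  quotmod_scale a (quotmod_scale b x) = quotmod_scale (a * b) x.
Proof. by elim/quotW: x => x; rewrite (quotmod_scale_pi b) !quotmod_scale_pi scalerA. Qed.

Fact quotmod_scale1 x : quotmod_scale 1 x = x.
Proof. by elim/quotW: x => x; rewrite !quotmod_scale_pi scale1r. Qed.

Fact quotmod_scaleDr a x y :
  quotmod_scale a (x + y) = quotmod_scale a x + quotmod_scale a y.
Proof.
by elim/quotW: x => x; elim/quotW: y => y; rewrite -raddfD !quotmod_scale_pi scalerDr raddfD.
Qed.

Fact quotmod_scaleDl x a b :
  quotmod_scale (a + b) x = quotmod_scale a x + quotmod_scale b x.
Proof. by elim/quotW: x => x; rewrite !quotmod_scale_pi scalerDl raddfD. Qed.

HB.instance Definition _ := GRing.Zmodule_isLmodule.Build R quotmod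
  quotmod_scaleA quotmod_scale1 quotmod_scaleDr quotmod_scaleDl.

End QuotientModule.

Section Kernel.
Variables (R : nzRingType) (U V : lmodType R) (f : {linear U -> V}).

Definition lin_ker : {pred U} := fun u => f u == 0.

Fact lin_ker_submod : submod_closed lin_ker.
Proof.
split=> [|a u v]; rewrite !unfold_in ?linear0 // => /eqP fu /eqP fv.
by rewrite linearP fu fv scaler0 addr0.
Qed.

HB.instance Definition _ := GRing.isSubmodClosed.Build R U lin_ker lin_ker_submod.

End Kernel.

Section FreeModule.
Variables (R : comNzRingType) (K : choiceType) (M : lmodType R) (f : K -> M).

Fact fglift_is_linear : linear (fglift f : {freeg K / R} -> M).
Proof.
pose F : {freeg K / R} -> M := fglift f.
pose F_additive := GRing.isZmodMorphism.Build _ _ F (@lift_is_additive R K M f).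
pose Fadd : {additive {freeg K / R} -> M} := HB.pack F F_additive.
move=> a u v; rewrite -[fglift f]/(Fadd : _ -> _) raddfD; congr (_ + _).
rewrite -[u in RHS]freeg_sumE -[a *: u]/(fgscale a u) /fgscale !raddf_sum /=.
by apply: eq_bigr => x _; rewrite /F !liftU scalerA.
Qed.

HB.instance Definition _ :=
  GRing.isLinear.Build R {freeg K / R} M *:%R (fglift f) fglift_is_linear.

End FreeModule.

Section Resolution.
Variable R : comNzRingType.

Record arrow := Arrow {
  arrow_src : lmodType R; arrow_tgt : lmodType R;
  arrow_map :> {linear arrow_src -> arrow_tgt} }.

Definition free_cover (M : lmodType R) : arrow :=
  @Arrow {freeg M / R} M (fglift (fun m : M => m)).

Definition free_cover_ker (f : arrow) : arrow :=
  @Arrow {freeg (submod (lin_ker f)) / R} (arrow_src f)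
    (fglift (@submod_val _ _ (lin_ker f))).

End Resolution.

Section Ext.
Variables (R : comNzRingType) (M N : lmodType R).

(* The standard free resolution of M: F_0 is free on the elements of M, F_1 is
   free on those of the kernel of F_0 -> M, and F_{n+2} is free on those of the
   kernel of F_{n+1} -> F_n; every basis element is mapped to itself. *)
Fixpoint res_arrow (n : nat) : arrow R :=
  if n is n'.+1 then free_cover_ker (res_arrow n') else free_cover M.

Definition res_obj n : lmodType R := arrow_src (res_arrow n).
Definition res_aug : {linear res_obj 0 -> M} := res_arrow 0.
Definition res_diff n : {linear res_obj n.+1 -> res_obj n} := res_arrow n.+1.

Definition cocycle n : {pred res_obj n -> N} := fun f =>
  `[< linear f /\ forall x, f (res_diff n x) = 0 >].

Arguments cocycle : clear implicits.

Fact cocycle_submod n : submod_closed (cocycle n).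
Proof.
split=> [|a f g /asboolP[flin f0] /asboolP[glin g0]]; apply/asboolP; split=> //.
- by move=> a x y; rewrite /= scaler0 addr0.
- move=> b x y; rewrite !fctE flin glin !scalerDr !scalerA mulrC.
  by rewrite -!addrA; congr (_ + _); rewrite addrCA.
- by move=> x; rewrite !fctE f0 g0 scaler0 addr0.
Qed.

HB.instance Definition _ n :=
  GRing.isSubmodClosed.Build R (res_obj n -> N) (cocycle n) (cocycle_submod n).

Definition coboundary n : {pred submod (cocycle n)} :=
  match n return {pred submod (cocycle n)} with
  | 0 => fun f => f == 0
  | n'.+1 => fun f =>
      `[< exists h : {linear res_obj n' -> N},
            submod_val f = (fun x => h (res_diff n' x)) >]
  end.

Arguments coboundary : clear implicits.

Fact coboundary_submod n : submod_closed (coboundary n).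
Proof.
case: n => [|n]; split=> [|a f g].
- exact: eqxx.
- by rewrite !unfold_in => /eqP -> /eqP ->; rewrite scaler0 addr0.
- by apply/asboolP; exists \0.
- move=> /asboolP[h fE] /asboolP[k gE]; apply/asboolP.
  by exists (a \*: h \+ k); rewrite /= fE gE.
Qed.

HB.instance Definition _ n := GRing.isSubmodClosed.Build R (submod (cocycle n))
  (coboundary n) (coboundary_submod n).

Definition Ext n : lmodType R := quotmod (coboundary n).

End Ext.

Section Annihilator.
Variables (R : comNzRingType) (M : lmodType R).

Definition annihilator : {pred R^o} := fun a => `[< forall m : M, a *: m = 0 >].

Fact annihilator_submod : submod_closed annihilator.
Proof.
split=> [|a x y /asboolP xM /asboolP yM]; apply/asboolP => m.
  by rewrite scale0r.
by rewrite scalerDl -scalerA xM yM scaler0 addr0.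
Qed.

HB.instance Definition _ :=
  GRing.isSubmodClosed.Build R R^o annihilator annihilator_submod.

End Annihilator.

Section Grade.
Variable R : comNzRingType.

Definition in_span (s : seq R) (x : R) : Prop :=
  exists c : 'I_(size s) -> R, x = \sum_i c i * s`_i.

Definition regular_seq (s : seq R) : Prop :=
  (forall i y, (i < size s)%N ->
     in_span (take i s) (s`_i * y) -> in_span (take i s) y)
  /\ ~ in_span s 1.

(* The largest length of a regular sequence contained in I (0 if there is no
   largest one; there is one for every proper ideal of a Noetherian ring). *)
Definition grade (I : submodClosed R^o) : nat :=
  let lengths := [set size s | s in [set s : seq R |
                   regular_seq s /\ {subset s <= (I : {pred R})}]]%classic in
  xget 0%N [set n | lengths n /\ forall k, lengths k -> (k <= n)%N]%classic.

Definition noetherian : Prop :=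
  forall J : submodClosed R^o, exists s : seq R,
    forall x : R, x \in (J : {pred R}) <-> in_span s x.

Definition maximal_ideal (m : submodClosed R^o) : Prop :=
  1 \notin m /\
  forall J : submodClosed R^o, {subset m <= J} -> 1 \notin J -> J =i m.

Definition local_ring : Prop :=
  exists m, maximal_ideal m /\ forall m', maximal_ideal m' -> m' =i m.

End Grade.

Definition Dideal (R : comNzRingType) (I : submodClosed R^o) : submodClosed R^o :=
  annihilator (Ext (quotmod I) R^o (grade I)).

(* Main.v *)
Require Import Defs.
From HB Require Import structures.
From mathcomp Require Import all_boot all_algebra.
From mathcomp Require Import ring_quotient.
From mathcomp Require Import boolp classical_sets functions.
From mathcomp Require Import freeg.

(** Let [s] be a regular sequence in [I] of length [g = grade I] and write
    [K : L] for the ideal of the [x] with [x L <= K].  Dimension shifting along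
    [s] gives [Ext^g(R/I, R) = Hom(R/I, R/(s)) = ((s) : I)/(s)], so that
    [D(I) = (s) : ((s) : I)] ([Dideal_colon]).  If moreover [grade D(I) = g],
    then [s], which also lies in [D(I)], computes [D(D(I))] in the same way, and
    the theorem is the identity [K : (K : (K : I)) = K : I] of a Galois
    connection, taken at [K = (s)].

    The grade does not jump: the shifting also shows that [Ext^i(R/J, R)]
    vanishes for [i] less than the length of any regular sequence in [J], so
    that a nonzero [Ext^n(R/J, R)] bounds these lengths by [n]
    ([regular_seq_leq]).  When [D(I)] is proper there is [y] outside [(s)] with
    [I y <= (s)]; then [D(I) y <= (s)], so [Ext^g(R/D(I), R)], which is
    [Hom(R/D(I), R/(s))], is nonzero ([grade_Dideal]).  When [D(I) = R], the
    inclusion [J <= D(J)] at [J = D(I)] already gives [D(D(I)) = R].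

    Neither quotient rings nor long exact sequences are built for the shifting:
    since the modules [F_n] of the resolution are free, every linear map from
    [F_n] to [R/K] lifts to [R], and a class of [Ext^n(M, R/K)] is treated as a
    linear map from [F_n] to [R] that is a cocycle modulo [K]. *)

Import GRing.Theory.
Local Open Scope ring_scope.
Local Open Scope quotient_scope.

Set Implicit Arguments.
Unset Strict Implicit.
Unset Printing Implicit Defensive.

(** * Lifting linear maps out of free modules *)

Section Projective.
Variable R : comNzRingType.

(** A nonempty relation with this property is a submodule of [U * V]:
    taking [a = -1] and [u = u'], [v = v'] shows that it contains 0. *)
Definition linear_rel (U V : lmodType R) (rel : U -> V -> Prop) : Prop :=
  forall a u v u' v', rel u v -> rel u' v' -> rel (a *: u + u') (a *: v + v').

(** The lifting property is stated for relations because every lift below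
    is prescribed only up to an ambiguity (modulo an ideal, or modulo a
    kernel): the relation records the allowed values. *)
Definition projective (P : lmodType R) : Prop :=
  forall (V : lmodType R) (rel : P -> V -> Prop), linear_rel rel ->
  (forall u, exists v, rel u v) ->
  exists h : {linear P -> V}, forall u, rel u (h u).

Lemma freegUZ (K : choiceType) (k : R) (x : K) :
  << k *g x >> = k *: << x >> :> {freeg K / R}.
Proof.
apply/eqP/freeg_eqP => z.
by rewrite -[k *: _]/(fgscale k _) coeff_fgscale !coeffU mul1r.
Qed.

(** Choose an allowed value on each basis element and extend linearly. *)
Lemma freeg_projective (K : choiceType) : projective {freeg K / R}.
Proof.
move=> V rel lin tot.
have [g gE] := choice (fun x : K => tot << x >>).
pose h : {linear {freeg K / R} -> V} := fglift g.
exists h => u; elim/freeg_ind_dom0: u => [|k x u _ _ IH].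
  (* A total linear relation relates 0 to 0. *)
  have [v v0] := tot 0; have := lin (-1) _ _ _ _ v0 v0.
  by rewrite scaler0 addr0 scaleN1r addNr linear0.
by rewrite linearD /= liftU freegUZ; apply: lin.
Qed.

End Projective.

(** * Exactness of the standard resolution *)

Section Resolution.
Variables (R : comNzRingType) (M : lmodType R).

Lemma res_projective n : projective (res_obj M n).
Proof. by case: n => [|n]; apply: freeg_projective. Qed.

Lemma res_aug_surj m : exists z, res_aug M z = m.
Proof. by exists << m >>; rewrite /res_aug /= liftU scale1r. Qed.

Lemma res_diffK n x : res_arrow M n (res_diff M n x) = 0.
Proof.
elim/freeg_ind_dom0: x => [|k x u _ _ IH]; first by rewrite !linear0.
rewrite !linearD IH addr0 /= liftU linearZ /=.
by case: x => x /= /eqP ->; rewrite scaler0.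
Qed.

Lemma res_exact n x :
  res_arrow M n x = 0 -> exists y, res_diff M n y = x.
Proof.
move=> x0; have kx : x \in lin_ker (res_arrow M n) by apply/eqP.
by exists << Submod kx >>; rewrite /res_diff /= liftU scale1r.
Qed.

End Resolution.

(** * Ext with coefficients modulo an ideal *)

Section ExtModIdeal.
Variables (R : comNzRingType) (M : lmodType R).

(** In degree 0 the only coboundary is zero, as in the definition of [Ext]:
    the augmentation is not part of the complex. *)
Definition is_coboundary n (f : {linear res_obj M n -> R^o}) : Prop :=
  match n return ({linear res_obj M n -> R^o}) -> Prop with
  | 0 => fun f => forall x, f x = 0
  | n'.+1 => fun f =>
      exists h : {linear res_obj M n' -> R^o},
        forall x, f x = h (res_diff M n' x)
  end f.

(** This says that [c] annihilates [Ext^n(M, R/K)], with cocycles and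
    coboundaries lifted from [R/K] to [R].  The case [c = 1] expresses that this
    module is zero. *)
Definition kills_Ext (K : submodClosed R^o) n (c : R) : Prop :=
  forall f : {linear res_obj M n -> R^o},
    (forall x, f (res_diff M n x) \in K) ->
  exists2 b, is_coboundary b & forall x, c *: f x - b x \in K.

Lemma coboundary_diff n (b : {linear res_obj M n -> R^o}) x :
  is_coboundary b -> b (res_diff M n x) = 0.
Proof.
case: n b x => [|n] b x /= => [-> // | [h ->]].
by have := res_diffK x; rewrite /res_diff /= => ->; rewrite linear0.
Qed.

(** Multiplication by [a] is zero on [M], hence null-homotopic on the
    resolution.  Here [t] is one stage of the homotopy, and the equation is the
    homotopy formula [a = d t + t d] composed with [d]; keeping it in this form
    treats the augmentation and the higher differentials alike, and [t = 0] on
    [M] starts the induction. *)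
Lemma homotopy a n : (forall m : M, a *: m = 0) ->
  exists t : {linear arrow_tgt (res_arrow M n) -> res_obj M n},
  forall x, res_arrow M n (t (res_arrow M n x)) = a *: res_arrow M n x.
Proof.
move=> aM; elim: n => [|n [t tE]].
  by exists \0 => x; rewrite /= aM -[fglift _ _]/(res_aug M 0) linear0.
pose rel x y := res_diff M n y = a *: x - t (res_arrow M n x).
have rel_lin : linear_rel rel.
  move=> b u v u' v'; rewrite /rel => uv u'v'.
  rewrite [LHS]linearP uv u'v' [res_arrow M n (_ + _)]linearP
    [t (_ + _)]linearP.
  by rewrite scalerBr scalerDr !scalerA [b * a]mulrC opprD addrACA.
have [|s sE] := res_projective rel_lin.
  by move=> u; apply: res_exact; rewrite linearB linearZ /= tE subrr.
exists s => x; rewrite [LHS]sE.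
by have := res_diffK x; rewrite /res_diff => ->; rewrite linear0 subr0.
Qed.

(** If [d t d = a d] then [a x - t (d x)] is a cycle, hence a boundary, and
    a cocycle [f] sends it into [K]: modulo [K], [a f] is the coboundary
    [f t d]. *)
Lemma ann_kills_Ext a K n : (forall m : M, a *: m = 0) -> kills_Ext K n a.
Proof.
move=> aM f fK; have [t tE] := homotopy n aM.
have kE x : exists y, res_diff M n y = a *: x - t (res_arrow M n x).
  by apply: res_exact; rewrite linearB linearZ /= tE subrr.
case: n f fK t tE kE => [|n] f fK t tE kE.
  exists \0 => // x; rewrite subr0.
  (* On M itself multiplication by a vanishes, so a x is a boundary. *)
  have [|y yE] := @res_exact _ M 0 (a *: x).
    by rewrite linearZ /= aM.
  by rewrite -linearZ -yE.
exists (f \o (t \o res_diff M n)) => [|x]; first by exists (f \o t).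
by have [y yE] := kE x; rewrite -linearZ -linearB -yE.
Qed.

Variables (K K' : submodClosed R^o) (a : R).
Hypothesis K'E : forall x, x \in K' <-> exists b : R^o, x - a *: b \in K.
Hypothesis a_reg : forall x : R^o, a *: x \in K -> x \in K.
Hypothesis aM : forall m : M, a *: m = 0.

(** Membership in [K' = K + aR] provides a quotient by [a] modulo [K], and
    projectivity makes the choice of this quotient linear. *)
Lemma factor_mod n (f : {linear res_obj M n -> R^o}) :
  (forall x, f x \in K') ->
  exists g : {linear res_obj M n -> R^o}, forall x, f x - a *: g x \in K.
Proof.
move=> fK'; apply: (res_projective (rel := fun x b => f x - a *: b \in K)).
  move=> k u v u' v' uv u'v'.
  suff -> : f (k *: u + u') - a *: (k *: v + v') =
     k *: (f u - a *: v) + (f u' - a *: v') by rewrite rpredD ?rpredZ.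
  rewrite linearP scalerBr scalerDr !scalerA [a * k]mulrC opprD.
  by rewrite addrACA.
by move=> x; apply/K'E.
Qed.

(** With [kills_Ext_shift_down], this is the connecting map of
    [0 -> R/K -> R/K -> R/K' -> 0], the first arrow being multiplication by [a],
    which acts as zero on [Ext].  For a cocycle [f] modulo [K], [a f] is
    bounded by some [h]; this [h] is a cocycle modulo [K'], and [f] is the image
    of its class.  If [c h = l + a m] modulo [K] with [l] a coboundary, then
    [a c f = a m d], and [a] can be cancelled. *)
Lemma kills_Ext_shift_up n c : kills_Ext K' n c -> kills_Ext K n.+1 c.
Proof.
move=> cK' f fK; have [b [h hE] bE] := ann_kills_Ext aM fK.
have [x|l l_bd lE] := cK' h.
  apply/K'E; exists (f x).
  by rewrite -hE -opprB -scaleN1r rpredZ.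
have [m mE] := factor_mod (f := (c \*: h) \- l) lE.
exists (m \o res_diff M n) => [|x]; first by exists m.
apply: a_reg.
have -> : a *: (c *: f x - (m \o res_diff M n) x) = c *: (a *: f x - b x) +
    ((c *: h (res_diff M n x) - l (res_diff M n x)) - a *: m (res_diff M n x)).
  rewrite (coboundary_diff x l_bd) subr0 -hE !scalerBr !scalerA [a * c]mulrC.
  by rewrite addrA subrK.
by rewrite rpredD ?rpredZ // mE.
Qed.

(** A cocycle [g] modulo [K'] satisfies [g d = a f] modulo [K], where [f] is
    a cocycle representing the image of [g].  If [c f = h d] then [c g - a h] is
    a cocycle modulo [K], hence a coboundary since [Ext^n(M, R/K) = 0], and
    modulo [K'] it equals [c g]. *)
Lemma kills_Ext_shift_down n c :
  kills_Ext K n 1 -> kills_Ext K n.+1 c -> kills_Ext K' n c.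
Proof.
move=> K1 cK g gK'.
have [f fE] := factor_mod (f := g \o res_diff M n) gK'.
have [x|b [h hE] bE] := cK f.
  apply: a_reg; have := rpredZ (-1) (fE (res_diff M n.+1 x)).
  by rewrite /= [res_diff M n _]res_diffK linear0 sub0r scaleN1r opprK.
have [x|l l_bd lE] := K1 ((c \*: g) \- (a \*: h)).
  rewrite /= -hE.
  have -> : c *: g (res_diff M n x) - a *: b x =
      c *: (g (res_diff M n x) - a *: f x) + a *: (c *: f x - b x).
    rewrite !scalerBr !scalerA [c * a]mulrC addrA subrK //.
  by rewrite rpredD ?rpredZ // fE.
exists l => // x; apply/K'E; exists (h x).
by have := lE x; rewrite scale1r /= addrAC.
Qed.

(** There is no nonzero map from [M], killed by [a], to [R/K], where [a] is
    regular. *)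
Lemma kills_Ext0 : kills_Ext K 0 1.
Proof.
move=> f fK; exists \0 => // x; rewrite scale1r subr0; apply: a_reg.
by have [b b0 bE] := ann_kills_Ext aM fK; rewrite -[_ *: _]subr0 -(b0 x).
Qed.

End ExtModIdeal.

(** * Ideals spanned by sequences *)

Section Span.
Variable R : comNzRingType.
Implicit Types s : seq R.

(** Coefficients indexed by all natural numbers make sequences of different
    lengths comparable. *)
Lemma in_spanP s (x : R) :
  in_span s x <-> exists c : nat -> R, x = \sum_(i < size s) c i * s`_i.
Proof.
split=> [[c ->]|[c ->]]; last by exists (fun i => c i).
exists (fun i => oapp c 0 (insub i)).
by apply: eq_bigr => i _; rewrite valK.
Qed.

Definition span_ideal s : {pred R^o} := fun x => `[< in_span s x >].

Fact span_ideal_submod s : submod_closed (span_ideal s).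
Proof.
split=> [|a x y /asboolP[c ->] /asboolP[d ->]]; apply/asboolP.
  by exists (fun=> 0); rewrite big1 // => i _; rewrite mul0r.
exists (fun i => a * c i + d i); rewrite scaler_sumr -big_split /=.
by apply: eq_bigr => i _; rewrite mulrDl -mulrA.
Qed.

HB.instance Definition _ s := GRing.isSubmodClosed.Build R R^o (span_ideal s)
  (span_ideal_submod s).

Lemma span_idealP s x : reflect (in_span s x) (x \in span_ideal s).
Proof. exact: asboolP. Qed.

Lemma span_ideal_nil x : x \in span_ideal [::] -> x = 0.
Proof. by move=> /span_idealP[c ->]; rewrite big_ord0. Qed.

Lemma span_ideal_rcons s (a : R) (x : R^o) :
  x \in span_ideal (rcons s a) <-> exists b : R^o, x - a *: b \in span_ideal s.
Proof.
have sumE (c : nat -> R) : \sum_(i < size (rcons s a)) c i * (rcons s a)`_i =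
    \sum_(i < size s) c i * s`_i + c (size s) * a.
  rewrite size_rcons big_ord_recr /= nth_rcons ltnn eqxx; congr (_ + _).
  by apply: eq_bigr => i _; rewrite nth_rcons ltn_ord.
split=> [/span_idealP/in_spanP[c ->]|[b /span_idealP/in_spanP[c cE]]].
  exists (c (size s)); rewrite (sumE c) [_ *: _]mulrC addrK.
  by apply/span_idealP/in_spanP; exists c.
apply/span_idealP/in_spanP.
pose d i := if (i < size s)%N then c i else b.
exists d; rewrite (sumE d) /d ltnn -[LHS](subrK (a *: b)) cE [_ *: _]mulrC.
congr (_ + _).
by apply: eq_bigr => i _; rewrite ltn_ord.
Qed.

End Span.

(** * Annihilators of Ext and Hom as ideals *)

Section Quotient.
Variables (R : comNzRingType) (J : submodClosed R^o).

Lemma quotmod_piE (V : lmodType R) (W : submodClosed V) (u v : V) :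
  (\pi_(quotmod W) u = \pi_(quotmod W) v) <-> u - v \in W.
Proof.
have /= -> : (u - v \in W) = (\pi_(quotmod W) u == \pi_(quotmod W) v).
  exact: (Quotient.idealrBE (submod_zmod W)).
by split=> /eqP.
Qed.

Lemma quotmod_piZ (V : lmodType R) (W : submodClosed V) a (v : V) :
  a *: \pi_(quotmod W) v = \pi_(quotmod W) (a *: v).
Proof. exact: quotmod_scale_pi. Qed.

Lemma quotmod_pi0 (V : lmodType R) (W : submodClosed V) (v : V) :
  (\pi_(quotmod W) v = 0) <-> v \in W.
Proof.
rewrite -[v in v \in W]subr0 -quotmod_piE.
by have -> : \pi_(quotmod W) 0 = 0 by rewrite raddf0.
Qed.

Lemma ideal_kills_quotmod a : a \in J -> forall m : quotmod J, a *: m = 0.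
Proof.
move=> aJ m; elim/quotW: m => v; rewrite quotmod_piZ; apply/quotmod_pi0.
by rewrite [_ *: _]mulrC; apply: (rpredZ (v : R) aJ).
Qed.

(** The zero ideal is written as the span of the empty sequence, the first
    in the chain of ideals spanned by the initial segments of a sequence. *)
Lemma annihilator_Ext (M : lmodType R) n c :
  c \in annihilator (Ext M R^o n) <-> kills_Ext M (span_ideal [::]) n c.
Proof.
split=> [/asboolP cE f fK|cK].
  have f_cocycle : (f : res_obj M n -> R^o) \in @cocycle R M R^o n.
    apply/asboolP; split=> [|x]; first exact: linearP.
    exact/span_ideal_nil/fK.
  have := cE (\pi_(Ext M R^o n) (Submod f_cocycle)).
  rewrite quotmod_piZ => /quotmod_pi0 cf_cobound.
  suff [b b_bd bE] : exists2 b : {linear res_obj M n -> R^o},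
      is_coboundary b & forall x, c *: f x = b x.
    by exists b => // x; rewrite bE subrr rpred0.
  case: n f f_cocycle cf_cobound {fK cE} => [|n] f f_cocycle.
    move=> /eqP cf0; exists (c \*: f) => // x.
    by have := congr1 (fun g : submod _ => submod_val g x) cf0; apply.
  move=> /asboolP[h hE]; exists (c \*: f) => //; exists h => x.
  by have := congr1 (fun g => g x) hE; apply.
apply/asboolP => m; elim/quotW: m => -[f f_cocycle].
rewrite quotmod_piZ; apply/quotmod_pi0.
have [f_lin fd] := asboolW f_cocycle.
pose f_isLinear := GRing.isLinear.Build R (res_obj M n) R^o *:%R f f_lin.
pose fL : {linear res_obj M n -> R^o} := HB.pack f f_isLinear.
have [x|b b_bd bE] := cK fL.
  by rewrite [fL _]fd rpred0.
have {}bE x : c *: f x = b x.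
  by apply/eqP; rewrite -subr_eq0; apply/eqP/span_ideal_nil/bE.
case: n f f_cocycle f_lin fd f_isLinear fL b b_bd bE {cK}
  => [|n] f f_cocycle f_lin fd _ _ b b_bd bE.
  by apply/eqP/val_inj/funext => x; rewrite [LHS]bE b_bd.
case: b_bd => h hE; apply/asboolP; exists h.
by apply/funext => x; rewrite -hE -bE.
Qed.

(** [Hom(R/J, R/K)] is [(K : J)/K], a map being determined by its value at
    the class of 1; its annihilator is [K : (K : J)]. *)
Lemma kills_Hom (K : submodClosed R^o) c :
  kills_Ext (quotmod J) K 0 c <->
  forall y : R^o, (forall j, j \in J -> j *: y \in K) -> c *: y \in K.
Proof.
pose one : quotmod J := \pi_(quotmod J) (1 : R^o).
have oneZ (r : R^o) : \pi_(quotmod J) r = r *: one.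
  by rewrite /one quotmod_piZ [_ *: _]mulr1.
split=> [cK y yK|cK f fK].
  (* The map 1 |-> y from R/J to R/K, composed with the augmentation, is
     lifted to R. *)
  pose rel (z : res_obj (quotmod J) 0) (b : R^o) :=
    exists2 r : R^o, res_aug (quotmod J) z = r *: one & b - r *: y \in K.
  have rel_lin : linear_rel rel.
    move=> a u v u' v' [r uE vK] [r' u'E v'K]; exists (a *: r + r').
      by rewrite linearP uE u'E scalerDl scalerA.
    have -> : a *: v + v' - (a *: r + r') *: y =
        a *: (v - r *: y) + (v' - r' *: y).
      by rewrite scalerDl scalerBr scalerA opprD addrACA.
    by rewrite rpredD ?rpredZ.
  have [z|f fE] := res_projective rel_lin.
    have [r rE] : exists r : R^o, res_aug (quotmod J) z = r *: one.
      by elim/quotW: (res_aug _ z) => r; exists r; rewrite oneZ.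
    by exists (r *: y); exists r => //; rewrite subrr rpred0.
  have aug_K z : res_aug (quotmod J) z = 0 -> f z \in K.
    move=> z0; have [r] := fE z.
    rewrite z0 -oneZ => /esym/quotmod_pi0 rJ fK.
    by rewrite -[f z](subrK (r *: y)) rpredD ?yK.
  have [x|b b0 bE] := cK f; first exact: aug_K (res_diffK (n := 0) x).
  have [e eE] := res_aug_surj one; have [r rE fr] := fE e.
  have rJ : (1 : R^o) - r \in J.
    apply/quotmod_piE; rewrite oneZ scale1r oneZ -rE.
    exact/esym.
  have fy : y - f e \in K.
    have -> : y - f e = (1 - r) *: y + - (f e - r *: y).
      by rewrite scalerBl scale1r opprB addrA subrK.
    by rewrite rpredD ?yK // -scaleN1r rpredZ.
  rewrite -[y](subrK (f e)) scalerDr rpredD //; first exact: rpredZ.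
  by have := bE e; rewrite (b0 e) subr0.
exists \0 => // z; rewrite subr0.
have [e eE] := res_aug_surj one.
have ker_K w : res_aug (quotmod J) w = 0 -> f w \in K.
  by move=> /(@res_exact _ _ 0)[x <-]; apply: fK.
have [r rE] : exists r : R^o, res_aug (quotmod J) z = r *: one.
  by elim/quotW: (res_aug _ z) => r; exists r; rewrite oneZ.
have cfe : c *: f e \in K.
  apply: cK => j jJ; rewrite -linearZ; apply: ker_K.
  by rewrite linearZ /= eE; apply: ideal_kills_quotmod.
rewrite -[z](subrK (r *: e)) linearD scalerDr rpredD //.
  by apply/rpredZ/ker_K; rewrite linearB linearZ /= eE rE subrr.
by rewrite linearZ /= scalerA mulrC -scalerA rpredZ.
Qed.

End Quotient.

(** * Dimension shifting along a regular sequence *)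

Section Grade.
Variables (R : comNzRingType) (J : submodClosed R^o) (s : seq R).
Hypotheses (s_reg : regular_seq s) (sJ : {subset s <= (J : {pred R})}).

Let K i : submodClosed R^o := span_ideal (take i s).

Lemma span_takeS i : (i < size s)%N ->
  forall x, x \in K i.+1 <-> exists b : R^o, x - s`_i *: b \in K i.
Proof. by move=> lt x; rewrite /K (take_nth 0) //; apply: span_ideal_rcons. Qed.

Lemma span_take_reg i : (i < size s)%N ->
  forall x : R^o, s`_i *: x \in K i -> x \in K i.
Proof.
move=> lt x /span_idealP h; apply/span_idealP.
exact: (proj1 s_reg) lt h.
Qed.

Lemma nth_kills_quotmod i : (i < size s)%N ->
  forall m : quotmod J, s`_i *: m = 0.
Proof. by move=> lt; apply/ideal_kills_quotmod/sJ/mem_nth. Qed.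

(** One element of [s] after [j] is used up by each step down to degree 0, and
    one more is needed there. *)
Lemma Ext_vanish i j : (i + j < size s)%N -> kills_Ext (quotmod J) (K j) i 1.
Proof.
elim: i j => [|i IH] j lt; have ltj := leq_ltn_trans (leq_addl _ _) lt.
  exact: kills_Ext0 (span_take_reg lt) (nth_kills_quotmod lt).
apply: (kills_Ext_shift_up (span_takeS ltj) (span_take_reg ltj)
         (nth_kills_quotmod ltj)).
by apply: IH; rewrite addnS.
Qed.

(** [Ext^i(R/J, R/(s_0, ..., s_(j-1)))] is [Hom(R/J, R/(s))]; the vanishing of
    [Ext^i] needed by each downward shift comes from [s] being one element too
    long for degree [i]. *)
Lemma Ext_Hom i j c : (i + j = size s)%N ->
  kills_Ext (quotmod J) (K j) i c <-> kills_Ext (quotmod J) (K (size s)) 0 c.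
Proof.
elim: i j => [|i IH] j ijE; first by rewrite add0n in ijE; rewrite ijE.
have ltj : (j < size s)%N by rewrite -ijE addSnnS leq_addl.
rewrite -(IH j.+1); last by rewrite addnS.
split; last exact: kills_Ext_shift_up (span_takeS ltj) (span_take_reg ltj)
  (nth_kills_quotmod ltj) _ _.
apply: (kills_Ext_shift_down (span_takeS ltj) (span_take_reg ltj)).
by apply: Ext_vanish; rewrite -ijE.
Qed.

Lemma annihilator_Ext_colon c :
  c \in annihilator (Ext (quotmod J) R^o (size s)) <->
  forall y : R^o, (forall j, j \in J -> j *: y \in span_ideal s) ->
    c *: y \in span_ideal s.
Proof.
have := Ext_Hom c (addn0 (size s)); rewrite /K take0 take_size => Ext_Hom_s.
apply: iff_trans (annihilator_Ext _ _ _) _.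
exact: iff_trans Ext_Hom_s (kills_Hom _ _ _).
Qed.

(** One half of the theorem of Rees that the grade of [J] is the least degree
    in which [Ext(R/J, R)] is nonzero. *)
Lemma regular_seq_leq n :
  1 \notin annihilator (Ext (quotmod J) R^o n) -> (size s <= n)%N.
Proof.
move=> n1; rewrite leqNgt; apply: contra n1 => lt.
apply/annihilator_Ext; have := @Ext_vanish n 0; rewrite addn0 /K take0.
exact.
Qed.

End Grade.

(** * The ideal D(I) *)

Section Duality.
Variable R : comNzRingType.
Implicit Type I : submodClosed R^o.

Lemma sub_Dideal I : {subset I <= Dideal I}.
Proof.
by move=> a aI; apply/annihilator_Ext/ann_kills_Ext/ideal_kills_quotmod.
Qed.

Lemma grade_unique I s :
  regular_seq s -> {subset s <= (I : {pred R})} ->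
  (forall t, regular_seq t -> {subset t <= (I : {pred R})} ->
    (size t <= size s)%N) ->
  grade I = size s.
Proof.
move=> s_reg sI s_max; rewrite /grade.
case: xgetP => [n _ [[t [tr tI] <-] mx]|].
  by apply/eqP; rewrite eqn_leq s_max //= mx //; exists s.
by move=> /(_ (size s)) []; split=> [|k [t [tr tI] <-]];
  [exists s | apply: s_max].
Qed.

Lemma regular_seq_nil : regular_seq ([::] : seq R).
Proof.
split=> // -[c /eqP]; by rewrite big_ord0 oner_eq0.
Qed.

(** If the lengths have no maximum, [grade I] is 0 by convention and the empty
    sequence has that length. *)
Lemma grade_witness I :
  exists2 s, regular_seq s /\ {subset s <= (I : {pred R})} & size s = grade I.
Proof.
have [g0|//] : grade I = 0%N \/ exists2 s,
    regular_seq s /\ {subset s <= (I : {pred R})} & size s = grade I.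
  rewrite /grade; case: xgetP => [n _ [[s sP <-] _]|_]; last by left.
  by right; exists s.
by exists [::]; rewrite ?g0 //; split=> //; exact: regular_seq_nil.
Qed.

Lemma Dideal_colon I s : regular_seq s -> {subset s <= (I : {pred R})} ->
  size s = grade I -> forall c, c \in Dideal I <->
  forall y : R^o, (forall j, j \in I -> j *: y \in span_ideal s) ->
    c *: y \in span_ideal s.
Proof.
by move=> sr sI sE c; rewrite /Dideal -sE; apply: annihilator_Ext_colon.
Qed.

(** [Hom(R/I, R/(s))] is nonzero because [D(I)] is proper, and a class [y]
    in [((s) : I)/(s)] is also killed by [D(I) = (s) : ((s) : I)], so it gives a
    nonzero element of [Hom(R/D(I), R/(s))]; hence [Ext] of [R/D(I)] is nonzero
    in degree [size s]. *)
Lemma grade_Dideal I s : regular_seq s -> {subset s <= (I : {pred R})} ->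
  size s = grade I -> 1 \notin Dideal I -> grade (Dideal I) = size s.
Proof.
move=> sr sI sE I1; have colon := Dideal_colon sr sI sE.
have sD : {subset s <= (Dideal I : {pred R})} by move=> x /sI /sub_Dideal.
apply: grade_unique => // t tr tD; apply: (regular_seq_leq tr tD).
apply: contra I1 => /(annihilator_Ext_colon sr sD) D1; apply/colon => y yI.
by apply: D1 => j /colon; apply.
Qed.

End Duality.

Theorem proposition3p4 (R : comNzRingType) (I : submodClosed R^o)
    (noethR : noetherian R) (localR : local_ring R) (properI : 1 \notin I) :
  Dideal (Dideal I) =i Dideal I.
Proof.
move=> c; apply/idP/idP => [|/sub_Dideal //].
have [I1 _|I1] := boolP (1 \in Dideal I).
  by rewrite -[c]mulr1; apply: (rpredZ c I1).
have [s [sr sI] sE] := grade_witness I.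
have colon := Dideal_colon sr sI sE.
have sD : {subset s <= (Dideal I : {pred R})} by move=> x /sI /sub_Dideal.
have gD := esym (grade_Dideal sr sI sE I1).
move=> /(Dideal_colon sr sD gD) cD; apply/colon => y yI.
by apply: cD => j /colon; apply.
Qed.
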